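(* Let $\mathbb C$ be a finitely cocomplete regular Mal'cev category which is locally algebraically cartesian closed. Then $\mathbb C$ is peri-abelian.
   Context: For a finitely complete category $\mathbb C$ and an object $Y$, $Pt_Y\mathbb C$ has as objects the pairs $(f:X\to Y,\ s:Y\to X)$ with $fs=1_Y$, and as morphisms the maps over $Y$ commuting with the sections. For $h:X\to Y$, $h^*:Pt_Y\mathbb C\to Pt_X\mathbb C$ is the change of base functor given by pulling back along $h$. $\mathbb C$ is locally algebraically cartesian closed when every $h^*$ has a right adjoint. A finitely complete category is Mal'cev when every reflexive relation in it is an equivalence relation (equivalently, every fibre $Pt_Y\mathbb C$ is unital, equivalently strongly unital). When $\mathbb D$ is a finitely cocomplete regular Mal'cev category, each fibre $Pt_Y\mathbb D$ is a regular strongly unital category with finite colimits, and the inclusion $Ab(Pt_Y\mathbb D)\rightarrowtail Pt_Y\mathbb D$ of the full subcategory of abelian objects (those carrying a, necessarily unique, internal abelian group structure) has a left adjoint $A_Y$, given on an object $P$ by the cokernel in $Pt_Y\mathbb D$ of the diagonal $P\rightarrowtail P\times P$; $A_Y(P)$ is the associated abelian object of $P$. A finitely cocomplete regular Mal'cev category $\mathbb D$ is peri-abelian when the change of base functor $h^*:Pt_{Y'}\mathbb D\to Pt_Y\mathbb D$ along any map $h:Y\to Y'$ preserves the associated abelian object, i.e. the canonical comparison $A_Y(h^*P)\to h^*(A_{Y'}P)$ is an isomorphism for every $P$ in $Pt_{Y'}\mathbb D$. *)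

(* Defs.v *)
From Stdlib Require Import ProofIrrelevance IndefiniteDescription.
From mathcomp Require Import ssreflect ssrfun ssrbool.

Set Implicit Arguments.
Unset Strict Implicit.
Unset Printing Implicit Defensive.

Record category := Category {
  Ob :> Type;
  Hom : Ob -> Ob -> Type;
  idm : forall x, Hom x x;
  comp : forall x y z, Hom y z -> Hom x y -> Hom x z;
  comp1m : forall x y (f : Hom x y), comp (idm y) f = f;
  compm1 : forall x y (f : Hom x y), comp f (idm x) = f;
  compA : forall x y z t (h : Hom z t) (g : Hom y z) (f : Hom x y),
    comp h (comp g f) = comp (comp h g) f }.

Arguments Hom {c} x y.
Arguments idm {c} x.
Arguments comp {c x y z} g f.

Declare Scope cat_scope.
Local Open Scope cat_scope.
Notation "g ∘ f" := (comp g f) (at level 40, left associativity) : cat_scope.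

Definition is_iso (C : category) (x y : C) (f : Hom x y) : Prop :=
  exists g : Hom y x, g ∘ f = idm x /\ f ∘ g = idm y.

Record functor (C D : category) := Functor {
  fob :> C -> D;
  fmap : forall x y : C, Hom x y -> Hom (fob x) (fob y);
  fmap1 : forall x : C, fmap (idm x) = idm (fob x);
  fmapM : forall (x y z : C) (g : Hom y z) (f : Hom x y),
    fmap (g ∘ f) = fmap g ∘ fmap f }.

Arguments fmap {C D} _ {x y} _.

Record adjunction (C D : category) (F : functor C D) (G : functor D C) :=
  Adjunction {
  transpose : forall (x : C) (y : D), Hom (F x) y -> Hom x (G y);
  untranspose : forall (x : C) (y : D), Hom x (G y) -> Hom (F x) y;
  transposeK : forall x y, cancel (@transpose x y) (@untranspose x y);
  untransposeK : forall x y, cancel (@untranspose x y) (@transpose x y);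
  transpose_nat : forall (x x' : C) (y y' : D)
    (u : Hom x' x) (f : Hom (F x) y) (v : Hom y y'),
    transpose (v ∘ f ∘ fmap F u) = fmap G v ∘ transpose f ∘ u }.

Arguments transpose {C D F G} _ {x y} _.
Arguments untranspose {C D F G} _ {x y} _.

Definition has_right_adjoint (C D : category) (F : functor C D) : Prop :=
  exists G : functor D C, inhabited (adjunction F G).

Program Definition full_subcategory (C : category) (A : C -> Prop) : category :=
  {| Ob := {x : C | A x};
     Hom := fun x y => Hom (sval x) (sval y);
     idm := fun x => idm (sval x);
     comp := fun x y z g f => g ∘ f |}.
Next Obligation. exact: comp1m. Qed.
Next Obligation. exact: compm1. Qed.
Next Obligation. exact: compA. Qed.

Program Definition inclusion (C : category) (A : C -> Prop) :
    functor (full_subcategory A) C :=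
  {| fob := fun x => sval x; fmap := fun x y f => f |}.

Record terminal (C : category) := Terminal {
  tm_ob :> C;
  tm_map : forall x : C, Hom x tm_ob;
  tm_uniq : forall (x : C) (u v : Hom x tm_ob), u = v }.

Record pullback (C : category) (x y z : C) (f : Hom x z) (g : Hom y z) :=
  Pullback {
  pb_ob :> C;
  pb_fst : Hom pb_ob x;
  pb_snd : Hom pb_ob y;
  pb_comm : f ∘ pb_fst = g ∘ pb_snd;
  pb_pair : forall (t : C) (a : Hom t x) (b : Hom t y),
    f ∘ a = g ∘ b -> Hom t pb_ob;
  pb_fstE : forall t (a : Hom t x) (b : Hom t y) (e : f ∘ a = g ∘ b),
    pb_fst ∘ pb_pair e = a;
  pb_sndE : forall t (a : Hom t x) (b : Hom t y) (e : f ∘ a = g ∘ b),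
    pb_snd ∘ pb_pair e = b;
  pb_uniq : forall (t : C) (u v : Hom t pb_ob),
    pb_fst ∘ u = pb_fst ∘ v -> pb_snd ∘ u = pb_snd ∘ v -> u = v }.

(** Finite completeness and cocompleteness are a choice of a terminal object and
    of pullbacks, respectively of an initial object and of pushouts; the other
    finite limits and colimits are built from these. *)
Record lexCategory := LexCategory {
  lex_cat :> category;
  lex_terminal : terminal lex_cat;
  lex_pb : forall (x y z : lex_cat) (f : Hom x z) (g : Hom y z), pullback f g }.

Arguments lex_pb {l x y z} f g.

Record initial (C : category) := Initial {
  in_ob :> C;
  in_map : forall x : C, Hom in_ob x;
  in_uniq : forall (x : C) (u v : Hom in_ob x), u = v }.

Record pushout (C : category) (x y z : C) (f : Hom z x) (g : Hom z y) :=
  Pushout {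
  po_ob :> C;
  po_inl : Hom x po_ob;
  po_inr : Hom y po_ob;
  po_comm : po_inl ∘ f = po_inr ∘ g;
  po_copair : forall (t : C) (a : Hom x t) (b : Hom y t),
    a ∘ f = b ∘ g -> Hom po_ob t;
  po_inlE : forall t (a : Hom x t) (b : Hom y t) (e : a ∘ f = b ∘ g),
    po_copair e ∘ po_inl = a;
  po_inrE : forall t (a : Hom x t) (b : Hom y t) (e : a ∘ f = b ∘ g),
    po_copair e ∘ po_inr = b;
  po_uniq : forall (t : C) (u v : Hom po_ob t),
    u ∘ po_inl = v ∘ po_inl -> u ∘ po_inr = v ∘ po_inr -> u = v }.

Record finitely_cocomplete (C : category) := FinitelyCocomplete {
  fc_initial : initial C;
  fc_po : forall (x y z : C) (f : Hom z x) (g : Hom z y), pushout f g }.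

Record product (C : category) (x y : C) := Product {
  pr_ob :> C;
  pr_fst : Hom pr_ob x;
  pr_snd : Hom pr_ob y;
  pr_pair : forall t : C, Hom t x -> Hom t y -> Hom t pr_ob;
  pr_fstE : forall t (a : Hom t x) (b : Hom t y), pr_fst ∘ pr_pair a b = a;
  pr_sndE : forall t (a : Hom t x) (b : Hom t y), pr_snd ∘ pr_pair a b = b;
  pr_uniq : forall (t : C) (u v : Hom t pr_ob),
    pr_fst ∘ u = pr_fst ∘ v -> pr_snd ∘ u = pr_snd ∘ v -> u = v }.

Arguments pr_pair {C x y} p {t} a b.

Record finite_products (C : category) := FiniteProducts {
  fp_terminal : terminal C;
  fp_prod : forall x y : C, product x y }.

Lemma pr_pair_comp (C : category) (x y : C) (p : product x y) (t s : C)
    (a : Hom t x) (b : Hom t y) (c : Hom s t) :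
  pr_pair p a b ∘ c = pr_pair p (a ∘ c) (b ∘ c).
Proof. by apply: pr_uniq; rewrite compA ?pr_fstE ?pr_sndE. Qed.

Lemma pr_pairE (C : category) (x y : C) (p : product x y) (t : C)
    (w : Hom t p) : pr_pair p (pr_fst p ∘ w) (pr_snd p ∘ w) = w.
Proof. by apply: pr_uniq; rewrite ?pr_fstE ?pr_sndE. Qed.

Lemma pr_pair_id (C : category) (x y : C) (p : product x y) :
  pr_pair p (pr_fst p) (pr_snd p) = idm p.
Proof. by apply: pr_uniq; rewrite ?pr_fstE ?pr_sndE compm1. Qed.

Definition is_coequalizer (C : category) (x y q : C)
    (u v : Hom x y) (e : Hom y q) : Prop :=
  e ∘ u = e ∘ v /\
  forall (t : C) (k : Hom y t), k ∘ u = k ∘ v -> exists! w : Hom q t, w ∘ e = k.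

Definition regular_epi (C : category) (x y : C) (e : Hom x y) : Prop :=
  exists (r : C) (u v : Hom r x), is_coequalizer u v e.

Definition regular (C : lexCategory) : Prop :=
  (forall (x y : C) (f : Hom x y) (k : pullback f f),
     exists (q : C) (e : Hom x q), is_coequalizer (pb_fst k) (pb_snd k) e) /\
  (forall (x y z : C) (e : Hom x y) (g : Hom z y) (k : pullback e g),
     regular_epi e -> regular_epi (pb_snd k)).

Definition is_relation (C : category) (r x y : C)
    (d0 : Hom r x) (d1 : Hom r y) : Prop :=
  forall (t : C) (u v : Hom t r), d0 ∘ u = d0 ∘ v -> d1 ∘ u = d1 ∘ v -> u = v.

Definition reflexive_rel (C : category) (r x : C) (d0 d1 : Hom r x) : Prop :=
  exists s : Hom x r, d0 ∘ s = idm x /\ d1 ∘ s = idm x.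

Definition symmetric_rel (C : category) (r x : C) (d0 d1 : Hom r x) : Prop :=
  exists s : Hom r r, d0 ∘ s = d1 /\ d1 ∘ s = d0.

Definition transitive_rel (C : lexCategory) (r x : C) (d0 d1 : Hom r x) : Prop :=
  let k := lex_pb d1 d0 in
  exists m : Hom k r, d0 ∘ m = d0 ∘ pb_fst k /\ d1 ∘ m = d1 ∘ pb_snd k.

Definition malcev (C : lexCategory) : Prop :=
  forall (r x : C) (d0 d1 : Hom r x),
    is_relation d0 d1 -> reflexive_rel d0 d1 ->
    [/\ reflexive_rel d0 d1, symmetric_rel d0 d1 & transitive_rel d0 d1].

Section Points.
Context (C : category) (Y : C).

Record pt_ob := PtOb {
  pt_dom :> C;
  pt_proj : Hom pt_dom Y;
  pt_sec : Hom Y pt_dom;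
  pt_split : pt_proj ∘ pt_sec = idm Y }.

Record pt_hom (P Q : pt_ob) := PtHom {
  pt_map :> Hom P Q;
  pt_map_proj : pt_proj Q ∘ pt_map = pt_proj P;
  pt_map_sec : pt_map ∘ pt_sec P = pt_sec Q }.

Lemma pt_hom_eq (P Q : pt_ob) (u v : pt_hom P Q) : pt_map u = pt_map v -> u = v.
Proof.
case: u => u up us; case: v => v vp vs /= e; case: _ / e vp vs => vp vs.
by rewrite (proof_irrelevance _ up vp) (proof_irrelevance _ us vs).
Qed.

Program Definition pt_id (P : pt_ob) : pt_hom P P := {| pt_map := idm P |}.
Next Obligation. exact: compm1. Qed.
Next Obligation. exact: comp1m. Qed.

Program Definition pt_comp (P Q R : pt_ob) (g : pt_hom Q R) (f : pt_hom P Q) :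
  pt_hom P R := {| pt_map := pt_map g ∘ pt_map f |}.
Next Obligation. by rewrite compA !pt_map_proj. Qed.
Next Obligation. by rewrite -compA !pt_map_sec. Qed.

Program Definition Pt : category :=
  {| Ob := pt_ob; Hom := pt_hom; idm := pt_id; comp := pt_comp |}.
Next Obligation. by apply: pt_hom_eq; apply: comp1m. Qed.
Next Obligation. by apply: pt_hom_eq; apply: compm1. Qed.
Next Obligation. by apply: pt_hom_eq; apply: compA. Qed.

Program Definition pt_zero (P Q : Pt) : Hom P Q :=
  {| pt_map := pt_sec Q ∘ pt_proj P |}.
Next Obligation. by rewrite compA pt_split comp1m. Qed.
Next Obligation. by rewrite -compA pt_split compm1. Qed.

Lemma pt_zero_comp (P Q R : Pt) (f : Hom P Q) : pt_zero Q R ∘ f = pt_zero P R.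
Proof. by apply: pt_hom_eq; rewrite /= -compA pt_map_proj. Qed.

Lemma pt_comp_zero (P Q R : Pt) (g : Hom Q R) : g ∘ pt_zero P Q = pt_zero P R.
Proof. by apply: pt_hom_eq; rewrite /= compA pt_map_sec. Qed.

End Points.

Arguments pt_zero {C Y} P Q.

Program Definition pt_terminal (C : category) (Y : C) : terminal (Pt Y) :=
  {| tm_ob := {| pt_dom := Y; pt_proj := idm Y; pt_sec := idm Y |};
     tm_map := fun P => {| pt_map := pt_proj P |} |}.
Next Obligation. by rewrite comp1m. Qed.
Next Obligation. by rewrite comp1m. Qed.
Next Obligation. exact: pt_split. Qed.
Next Obligation.
apply: pt_hom_eq.
by rewrite -[pt_map u]comp1m -[pt_map v]comp1m (pt_map_proj u) (pt_map_proj v).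
Qed.

(** Binary products in [Pt Y] are pullbacks over [Y]. *)
Program Definition pt_product (C : lexCategory) (Y : C) (P Q : Pt Y) :
    product P Q :=
  let k := lex_pb (pt_proj P) (pt_proj Q) in
  {| pr_ob := {| pt_dom := k; pt_proj := pt_proj P ∘ pb_fst k;
                 pt_sec := @pb_pair _ _ _ _ _ _ k _ (pt_sec P) (pt_sec Q) _ |};
     pr_fst := {| pt_map := pb_fst k |};
     pr_snd := {| pt_map := pb_snd k |};
     pr_pair := fun T a b =>
       {| pt_map := @pb_pair _ _ _ _ _ _ k _ (pt_map a) (pt_map b) _ |} |}.
Next Obligation. by rewrite !pt_split. Qed.
Next Obligation. by rewrite -compA pb_fstE pt_split. Qed.
Next Obligation. by rewrite pb_fstE. Qed.
Next Obligation. by rewrite pb_comm. Qed.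
Next Obligation. by rewrite pb_sndE. Qed.
Next Obligation. by rewrite !pt_map_proj. Qed.
Next Obligation. by rewrite -compA pb_fstE pt_map_proj. Qed.
Next Obligation.
by apply: pb_uniq; rewrite compA ?pb_fstE ?pb_sndE pt_map_sec.
Qed.
Next Obligation. by apply: pt_hom_eq; rewrite /= pb_fstE. Qed.
Next Obligation. by apply: pt_hom_eq; rewrite /= pb_sndE. Qed.
Next Obligation.
by apply: pt_hom_eq; apply: pb_uniq.
Qed.

Definition pt_products (C : lexCategory) (Y : C) : finite_products (Pt Y) :=
  {| fp_terminal := pt_terminal Y; fp_prod := @pt_product C Y |}.

Program Definition change_of_base (C : lexCategory) (Y Y' : C) (h : Hom Y Y') :
    functor (Pt Y') (Pt Y) :=
  {| fob := fun P => let k := lex_pb h (pt_proj P) in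
       {| pt_dom := k; pt_proj := pb_fst k;
          pt_sec := @pb_pair _ _ _ _ _ _ k _ (idm Y) (pt_sec P ∘ h) _ |};
     fmap := fun P Q f =>
       let k := lex_pb h (pt_proj P) in
       {| pt_map := @pb_pair _ _ _ _ _ _ (lex_pb h (pt_proj Q)) _
                      (pb_fst k) (pt_map f ∘ pb_snd k) _ |} |}.
Next Obligation. by rewrite compm1 compA pt_split comp1m. Qed.
Next Obligation. by rewrite pb_fstE. Qed.
Next Obligation. by rewrite compA pt_map_proj pb_comm. Qed.
Next Obligation. by rewrite pb_fstE. Qed.
Next Obligation.
apply: pb_uniq; rewrite compA ?pb_fstE ?pb_sndE //.
by rewrite /= -compA pb_sndE compA pt_map_sec.
Qed.
Next Obligation.
by apply: pt_hom_eq; apply: pb_uniq; rewrite /= ?pb_fstE ?pb_sndE ?compm1 ?comp1m.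
Qed.
Next Obligation.
apply: pt_hom_eq; apply: pb_uniq; rewrite /= compA ?pb_fstE ?pb_sndE //.
by rewrite -!compA pb_sndE.
Qed.

Definition locally_algebraically_cartesian_closed (C : lexCategory) : Prop :=
  forall (Y Y' : C) (h : Hom Y Y'), has_right_adjoint (change_of_base h).

Record abelian_group (C : category) (fp : finite_products C) (A : C) :=
  AbelianGroup {
  ag_add : Hom (fp_prod fp A A) A;
  ag_zero : Hom (fp_terminal fp) A;
  ag_opp : Hom A A;
  ag_addA :
    let AA := fp_prod fp A A in
    let AAA := fp_prod fp AA A in
    let x := pr_fst AA ∘ pr_fst AAA in
    let y := pr_snd AA ∘ pr_fst AAA in
    let z := pr_snd AAA in
    ag_add ∘ pr_pair AA x (ag_add ∘ pr_pair AA y z) =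
    ag_add ∘ pr_pair AA (ag_add ∘ pr_pair AA x y) z;
  ag_addC :
    let AA := fp_prod fp A A in
    ag_add ∘ pr_pair AA (pr_snd AA) (pr_fst AA) = ag_add;
  ag_add0 :
    ag_add ∘ pr_pair (fp_prod fp A A) (idm A) (ag_zero ∘ tm_map _ A) = idm A;
  ag_addN :
    ag_add ∘ pr_pair (fp_prod fp A A) (idm A) ag_opp = ag_zero ∘ tm_map _ A }.

Definition abelian_object (C : category) (fp : finite_products C) (A : C) : Prop :=
  inhabited (abelian_group fp A).

Definition Ab (C : lexCategory) (Y : C) : category :=
  full_subcategory (abelian_object (pt_products Y)).

Definition Ab_incl (C : lexCategory) (Y : C) : functor (Ab Y) (Pt Y) :=
  inclusion (abelian_object (pt_products Y)).

Lemma ag_addAE (C : category) (fp : finite_products C) (A : C)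
    (G : abelian_group fp A) (t : C) (a b c : Hom t A) :
  ag_add G ∘ pr_pair _ a (ag_add G ∘ pr_pair _ b c) =
  ag_add G ∘ pr_pair _ (ag_add G ∘ pr_pair _ a b) c.
Proof.
have := f_equal (fun w => w ∘ pr_pair _ (pr_pair _ a b) c) (ag_addA G) => /=.
by rewrite -!compA !pr_pair_comp -!compA !pr_pair_comp -!compA
  !(pr_fstE, pr_sndE).
Qed.

Lemma ag_addCE (C : category) (fp : finite_products C) (A : C)
    (G : abelian_group fp A) (t : C) (a b : Hom t A) :
  ag_add G ∘ pr_pair _ a b = ag_add G ∘ pr_pair _ b a.
Proof. by rewrite -{1}(ag_addC G) -compA pr_pair_comp pr_fstE pr_sndE. Qed.

Lemma ag_add0E (C : category) (fp : finite_products C) (A : C)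
    (G : abelian_group fp A) (t : C) (a : Hom t A) :
  ag_add G ∘ pr_pair _ a (ag_zero G ∘ tm_map _ t) = a.
Proof.
have := f_equal (fun w => w ∘ a) (ag_add0 G) => /=.
by rewrite -compA pr_pair_comp -compA comp1m (tm_uniq (_ ∘ a) (tm_map _ t)).
Qed.

Lemma ag_addNE (C : category) (fp : finite_products C) (A : C)
    (G : abelian_group fp A) (t : C) (a : Hom t A) :
  ag_add G ∘ pr_pair _ a (ag_opp G ∘ a) = ag_zero G ∘ tm_map _ t.
Proof.
have := f_equal (fun w => w ∘ a) (ag_addN G) => /=.
by rewrite -!compA pr_pair_comp comp1m (tm_uniq (_ ∘ a) (tm_map _ t)).
Qed.

Section PreserveAbelian.
Context (C D : category) (fpC : finite_products C) (fpD : finite_products D).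
Context (F : functor C D).

Definition preserves_products : Prop :=
  inhabited (Hom (fp_terminal fpD) (F (fp_terminal fpC))) /\
  (forall t (u v : Hom t (F (fp_terminal fpC))), u = v) /\
  forall x y : C, let p := fp_prod fpC x y in
  (exists w : Hom (fp_prod fpD (F x) (F y)) (F p),
     fmap F (pr_fst p) ∘ w = pr_fst _ /\ fmap F (pr_snd p) ∘ w = pr_snd _) /\
  forall t (u v : Hom t (F p)), fmap F (pr_fst p) ∘ u = fmap F (pr_fst p) ∘ v ->
    fmap F (pr_snd p) ∘ u = fmap F (pr_snd p) ∘ v -> u = v.

Lemma preserves_abelian (A : C) : preserves_products ->
  abelian_object fpC A -> abelian_object fpD (F A).
Proof.
move=> [[e] [e_uniq pP]] [G].
have [[w [w1 w2]] w_uniq] := pP A A.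
have wF t (a b : Hom t A) : w ∘ pr_pair _ (fmap F a) (fmap F b) =
    fmap F (pr_pair (fp_prod fpC A A) a b).
  by apply: w_uniq; rewrite compA ?w1 ?w2 -fmapM ?(pr_fstE, pr_sndE).
pose ad := fmap F (ag_add G) ∘ w.
have [[w' [w1' w2']] w_uniq'] := pP (fp_prod fpC A A) A.
have adF t s (m : Hom t (F s)) (a b : Hom s A) :
    ad ∘ pr_pair _ (fmap F a ∘ m) (fmap F b ∘ m) =
    fmap F (ag_add G ∘ pr_pair _ a b) ∘ m.
  by rewrite -pr_pair_comp compA -[ad ∘ _]compA wF -fmapM.
exists; exists ad (fmap F (ag_zero G) ∘ e) (fmap F (ag_opp G)) => /=.
- set AA := fp_prod fpD _ _; set AAA := fp_prod fpD AA _.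
  set BB := fp_prod fpC A A; set BBB := fp_prod fpC BB A.
  pose m : Hom AAA (F BBB) := w' ∘ pr_pair _ (w ∘ pr_fst AAA) (pr_snd AAA).
  have mz : pr_snd AAA = fmap F (pr_snd BBB) ∘ m by rewrite compA w2' pr_sndE.
  have mx : pr_fst AA ∘ pr_fst AAA = fmap F (pr_fst BB ∘ pr_fst BBB) ∘ m.
    by rewrite fmapM -compA [fmap F (pr_fst BBB) ∘ m]compA w1' pr_fstE compA w1.
  have my : pr_snd AA ∘ pr_fst AAA = fmap F (pr_snd BB ∘ pr_fst BBB) ∘ m.
    by rewrite fmapM -compA [fmap F (pr_fst BBB) ∘ m]compA w1' pr_fstE compA w2.
  by rewrite mx my mz !adF ag_addAE.
- set AA := fp_prod fpD _ _; set BB := fp_prod fpC A A.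
  by rewrite -{1}w1 -{1}w2 adF ag_addCE pr_pair_id compm1.
- have -> : fmap F (ag_zero G) ∘ e ∘ tm_map _ (F A) =
      fmap F (ag_zero G ∘ tm_map _ A) ∘ idm _.
    by rewrite fmapM compm1 -compA; congr (_ ∘ _); apply: e_uniq.
  by rewrite -{1}(fmap1 F) -[fmap F (idm A)]compm1 adF ag_add0E fmap1 comp1m.
- have -> : fmap F (ag_zero G) ∘ e ∘ tm_map _ (F A) =
      fmap F (ag_zero G ∘ tm_map _ A) ∘ idm _.
    by rewrite fmapM compm1 -compA; congr (_ ∘ _); apply: e_uniq.
  rewrite -{1}(fmap1 F) -[fmap F (idm A)]compm1 -[fmap F (ag_opp G)]compm1 adF.
  by rewrite ag_addN.
Qed.

End PreserveAbelian.

Section ChangeOfBase.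
Context (C : lexCategory) (Y Y' : C) (h : Hom Y Y').

Lemma cob_uniq (T : Pt Y) (P : Pt Y') (u v : Hom T (change_of_base h P)) :
  pb_snd (lex_pb h (pt_proj P)) ∘ pt_map u =
  pb_snd (lex_pb h (pt_proj P)) ∘ pt_map v -> u = v.
Proof.
move=> e; apply: pt_hom_eq; apply: pb_uniq => //.
exact: etrans (pt_map_proj u) (esym (pt_map_proj v)).
Qed.

Program Definition cob_pair (T : Pt Y) (P : Pt Y') (g : Hom (pt_dom T) (pt_dom P))
    (gp : pt_proj P ∘ g = h ∘ pt_proj T) (gs : g ∘ pt_sec T = pt_sec P ∘ h) :
    Hom T (change_of_base h P) :=
  {| pt_map := @pb_pair _ _ _ _ _ _ (lex_pb h (pt_proj P)) _ (pt_proj T) g _ |}.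
Next Obligation. by rewrite pb_fstE. Qed.
Next Obligation.
by apply: pb_uniq; rewrite compA ?pb_fstE ?pb_sndE ?pt_split.
Qed.

Lemma cob_preserves_products :
  preserves_products (pt_products Y') (pt_products Y) (change_of_base h).
Proof.
split; first by split; exact: pt_zero.
split.
  move=> t u v; apply: cob_uniq => /=.
  set k := lex_pb _ _.
  have e : pb_snd k = h ∘ pb_fst k by rewrite pb_comm comp1m.
  rewrite e -!compA; congr (_ ∘ _).
  exact: etrans (pt_map_proj u) (esym (pt_map_proj v)).
move=> P Q p; split; last first.
  move=> t u v e1 e2; apply: cob_uniq; apply: pb_uniq.
  - have := f_equal (fun w : Hom t (change_of_base h P) =>
      pb_snd (lex_pb h (pt_proj P)) ∘ pt_map w) e1.
    by rewrite /= !compA !pb_sndE.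
  - have := f_equal (fun w : Hom t (change_of_base h Q) =>
      pb_snd (lex_pb h (pt_proj Q)) ∘ pt_map w) e2.
    by rewrite /= !compA !pb_sndE.
pose T : Pt Y := fp_prod (pt_products Y) (change_of_base h P) (change_of_base h Q).
pose kP := lex_pb h (pt_proj P); pose kQ := lex_pb h (pt_proj Q).
pose k := lex_pb (pb_fst kP) (pb_fst kQ).
pose kPQ := lex_pb (pt_proj P) (pt_proj Q).
have e : pt_proj P ∘ (pb_snd kP ∘ pb_fst k) = pt_proj Q ∘ (pb_snd kQ ∘ pb_snd k).
  by rewrite !compA -!pb_comm -!compA pb_comm.
have gp : pt_proj (p : Pt Y') ∘ (pb_pair kPQ e) = h ∘ pt_proj T.
  by rewrite /= -compA pb_fstE !compA pb_comm.
have gs : pb_pair kPQ e ∘ pt_sec T = pt_sec (p : Pt Y') ∘ h.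
  by apply: pb_uniq; rewrite !compA ?pb_fstE ?pb_sndE /= -compA ?pb_fstE ?pb_sndE
    ?pb_fstE ?pb_sndE.
exists (@cob_pair T p _ gp gs); split; apply: cob_uniq.
- by rewrite /= compA pb_sndE -compA pb_sndE pb_fstE.
- by rewrite /= compA pb_sndE -compA pb_sndE pb_sndE.
Qed.

Definition cob_Ab (B : Ab Y') : Ab Y :=
  exist _ (change_of_base h (sval B))
    (preserves_abelian cob_preserves_products (proj2_sig B)).

End ChangeOfBase.

Section Coequalizers.
Context (C : category) (cC : finitely_cocomplete C) (x y : C) (u v : Hom x y).

(** The coequalizer of [u] and [v] is the pushout of [[u, v] : x + x -> y]
    along the codiagonal of [x]. *)
Let xx := fc_po cC (in_map (fc_initial cC) x) (in_map (fc_initial cC) x).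
Let codiag : Hom xx x := po_copair xx (erefl (idm x ∘ in_map (fc_initial cC) x)).
Let copair : Hom xx y := po_copair xx (in_uniq (u ∘ _) (v ∘ _)).

Definition coeq : pushout codiag copair := fc_po cC codiag copair.

Definition coeq_map : Hom y coeq := po_inr coeq.

Lemma coeq_mapE : coeq_map ∘ u = coeq_map ∘ v.
Proof.
have eu : po_inl coeq = coeq_map ∘ u.
  have := f_equal (fun w => w ∘ po_inl xx) (po_comm coeq).
  by rewrite /= -!compA !po_inlE compm1.
have ev : po_inl coeq = coeq_map ∘ v.
  have := f_equal (fun w => w ∘ po_inr xx) (po_comm coeq).
  by rewrite /= -!compA !po_inrE compm1.
by rewrite -eu -ev.
Qed.

Lemma coeq_desc_subproof (t : C) (k : Hom y t) : k ∘ u = k ∘ v ->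
  (k ∘ u) ∘ codiag = k ∘ copair.
Proof.
move=> e; apply: po_uniq; rewrite -!compA ?po_inlE ?po_inrE compm1 //.
Qed.

Definition coeq_desc (t : C) (k : Hom y t) (e : k ∘ u = k ∘ v) : Hom coeq t :=
  po_copair coeq (coeq_desc_subproof e).

Lemma coeq_descE (t : C) (k : Hom y t) (e : k ∘ u = k ∘ v) :
  coeq_desc e ∘ coeq_map = k.
Proof. exact: po_inrE. Qed.

Lemma coeq_uniq (t : C) (k l : Hom coeq t) :
  k ∘ coeq_map = l ∘ coeq_map -> k = l.
Proof.
move=> e; apply: po_uniq => //.
have eu : po_inl coeq = coeq_map ∘ u.
  have := f_equal (fun w => w ∘ po_inl xx) (po_comm coeq).
  by rewrite /= -!compA !po_inlE compm1.
by rewrite eu !compA e.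
Qed.

End Coequalizers.

Definition is_cokernel (C : category) (Y : C) (P Q K : Pt Y)
    (u : Hom P Q) (e : Hom Q K) : Prop :=
  e ∘ u = pt_zero P K /\
  forall (R : Pt Y) (k : Hom Q R), k ∘ u = pt_zero P R ->
    exists! w : Hom K R, w ∘ e = k.

Section Cokernels.
Context (C : category) (cC : finitely_cocomplete C) (Y : C).
Context (P Q : Pt Y) (u : Hom P Q).

Let z : Hom (pt_dom P) (pt_dom Q) := pt_map (pt_zero P Q).

Program Definition coker : Pt Y :=
  {| pt_dom := coeq cC (pt_map u) z;
     pt_proj := @coeq_desc _ cC _ _ (pt_map u) z _ (pt_proj Q) _;
     pt_sec := coeq_map cC (pt_map u) z ∘ pt_sec Q |}.
Next Obligation. by rewrite (pt_map_proj u) (pt_map_proj (pt_zero P Q)). Qed.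
Next Obligation. by rewrite compA coeq_descE pt_split. Qed.

Program Definition coker_map : Hom Q coker :=
  {| pt_map := coeq_map cC (pt_map u) z |}.
Next Obligation. by rewrite coeq_descE. Qed.

Lemma coker_mapP : is_cokernel u coker_map.
Proof.
have coker_zero : coker_map ∘ u = pt_zero P coker.
  rewrite -(pt_comp_zero P coker_map); apply: pt_hom_eq; exact: coeq_mapE.
split=> // R k e.
have e' : pt_map k ∘ pt_map u = pt_map k ∘ z.
  rewrite -[RHS]/(pt_map (k ∘ pt_zero P Q)) pt_comp_zero -e //.
have wp : pt_proj R ∘ coeq_desc cC e' = pt_proj coker.
  by apply: coeq_uniq; rewrite -compA !coeq_descE pt_map_proj.
have ws : coeq_desc cC e' ∘ pt_sec coker = pt_sec R.
  by rewrite /= compA coeq_descE pt_map_sec.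
exists (@PtHom _ _ coker R _ wp ws); split.
  by apply: pt_hom_eq; rewrite /= coeq_descE.
move=> w ew; apply: pt_hom_eq; apply: coeq_uniq.
by rewrite coeq_descE -ew.
Qed.

End Cokernels.

Definition pt_diag (C : lexCategory) (Y : C) (P : Pt Y) :
    Hom P (pt_product P P) := pr_pair _ (idm P) (idm P).

Definition pt_inl (C : lexCategory) (Y : C) (P : Pt Y) :
    Hom P (pt_product P P) := pr_pair _ (idm P) (pt_zero P P).

Lemma pb_ex (C : category) (x y z : C) (f : Hom x z) (g : Hom y z)
    (p : pullback f g) (t : C) (a : Hom t x) (b : Hom t y) :
  f ∘ a = g ∘ b ->
  exists w : Hom t p, pb_fst p ∘ w = a /\ pb_snd p ∘ w = b.
Proof. by move=> e; exists (pb_pair p e); rewrite pb_fstE pb_sndE. Qed.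

Section Malcev.
Context (C : lexCategory) (mal : malcev C) (Y : C).

(** The diagonal and [(1, 0)] are jointly extremally epic in the fibres: this is
    their strong unitality. *)
Lemma malcev_section (P : Pt Y) (s : C)
    (j : Hom s (pt_dom (pt_product P P : Pt Y))) (d i : Hom (pt_dom P) s) :
  (forall t (a b : Hom t s), j ∘ a = j ∘ b -> a = b) ->
  j ∘ d = pt_map (pt_diag P) -> j ∘ i = pt_map (pt_inl P) ->
  exists r, j ∘ r = idm _.
Proof.
set k := lex_pb (pt_proj P) (pt_proj P) => jm jd ji.
pose d0 := pb_fst k ∘ j; pose d1 := pb_snd k ∘ j.
have rel : is_relation d0 d1.
  by move=> t a b; rewrite -!compA => e0 e1; apply: jm; apply: pb_uniq.
have refl : reflexive_rel d0 d1.
  by exists d; rewrite -!compA jd /= ?pb_fstE ?pb_sndE.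
have [_ [sg [sg0 sg1]] [m [m0 m1]]] := mal rel refl.
have i0 : d0 ∘ i = idm _ by rewrite -compA ji /= pb_fstE.
have i1 : d1 ∘ i = pt_sec P ∘ pt_proj P by rewrite -compA ji /= pb_sndE.
have e : d1 ∘ (i ∘ pb_fst k) = d0 ∘ (sg ∘ (i ∘ pb_snd k)).
  by rewrite !compA i1 sg0 i1 -!compA pb_comm.
have [w [w0 w1]] := pb_ex (lex_pb d1 d0) e.
exists (m ∘ w); apply: pb_uniq; rewrite compm1.
- transitivity (d0 ∘ m ∘ w); first by rewrite -!compA.
  by rewrite m0 -compA w0 compA i0 comp1m.
- transitivity (d1 ∘ m ∘ w); first by rewrite -!compA.
  by rewrite m1 -compA w1 !compA sg1 i0 comp1m.
Qed.

Lemma malcev_joint (P : Pt Y) (b : C)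
    (u v : Hom (pt_dom (pt_product P P : Pt Y)) b) :
  u ∘ pt_map (pt_diag P) = v ∘ pt_map (pt_diag P) ->
  u ∘ pt_map (pt_inl P) = v ∘ pt_map (pt_inl P) -> u = v.
Proof.
move=> ed ei.
set W := pt_dom _ in u v ed ei *.
have tmE t (f g : Hom t (lex_terminal C)) : f = g := tm_uniq f g.
pose bb := lex_pb (tm_map (lex_terminal C) b) (tm_map (lex_terminal C) b).
pose dg : Hom b bb := pb_pair bb (erefl (tm_map _ b ∘ idm b)).
have uvE : tm_map (lex_terminal C) b ∘ u = tm_map _ b ∘ v by apply: tmE.
pose uv : Hom W bb := pb_pair bb uvE.
pose k := lex_pb uv dg; pose j := pb_fst k.
have ju : u ∘ j = pb_snd k.
  have := f_equal (fun w => pb_fst bb ∘ w) (pb_comm k).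
  by rewrite /= !compA !pb_fstE comp1m.
have jv : v ∘ j = pb_snd k.
  have := f_equal (fun w => pb_snd bb ∘ w) (pb_comm k).
  by rewrite /= !compA !pb_sndE comp1m.
have jm t (a c : Hom t k) : j ∘ a = j ∘ c -> a = c.
  by move=> e; apply: pb_uniq => //; rewrite -ju -!compA -/j e.
have lift t (w : Hom t W) : u ∘ w = v ∘ w -> exists a : Hom t k, j ∘ a = w.
  move=> e; have e' : uv ∘ w = dg ∘ (u ∘ w).
    by apply: pb_uniq; rewrite !compA ?pb_fstE ?pb_sndE comp1m.
  by exists (pb_pair k e'); rewrite pb_fstE.
have [d jd] := lift _ _ ed; have [i ji] := lift _ _ ei.
have [r jr] := malcev_section jm jd ji.
by rewrite -[u]compm1 -[v]compm1 -jr !compA ju jv.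
Qed.

Lemma pt_joint (P B : Pt Y) (u v : Hom (pt_product P P : Pt Y) B) :
  u ∘ pt_diag P = v ∘ pt_diag P -> u ∘ pt_inl P = v ∘ pt_inl P -> u = v.
Proof.
move=> ed ei; apply: pt_hom_eq; apply: malcev_joint.
- exact: (f_equal (@pt_map _ _ _ _) ed).
- exact: (f_equal (@pt_map _ _ _ _) ei).
Qed.

Lemma pt_terminal_zero (P : Pt Y) (f : Hom (pt_terminal Y : Pt Y) P) :
  f ∘ tm_map (pt_terminal Y) P = pt_zero P P.
Proof.
have -> : f = pt_zero _ _; last exact: pt_zero_comp.
apply: pt_hom_eq; rewrite -[pt_map f]compm1 (pt_map_sec f) /= compm1 //.
Qed.

Lemma subtraction_abelian (A : Pt Y) (d : Hom (pt_product A A : Pt Y) A) :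
  d ∘ pt_diag A = pt_zero A A -> d ∘ pt_inl A = idm A ->
  abelian_object (pt_products Y) A.
Proof.
move=> dd di; set AA := pt_product A A in d dd di.
have ddE t (a : Hom t A) : d ∘ pr_pair AA a a = pt_zero t A.
  have <- : pt_diag A ∘ a = pr_pair AA a a by rewrite pr_pair_comp comp1m.
  by rewrite compA dd pt_zero_comp.
have diE t (a : Hom t A) : d ∘ pr_pair AA a (pt_zero t A) = a.
  have <- : pt_inl A ∘ a = pr_pair AA a (pt_zero t A).
    by rewrite pr_pair_comp comp1m pt_zero_comp.
  by rewrite compA di comp1m.
have dK t (a b : Hom t A) : d ∘ pr_pair AA a (d ∘ pr_pair AA a b) = b.
  suff e : d ∘ pr_pair AA (pr_fst AA) d = pr_snd AA.
    have := f_equal (fun w => w ∘ pr_pair AA a b) e.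
    by rewrite -compA pr_pair_comp pr_fstE pr_sndE.
  apply: pt_joint; rewrite -!compA pr_pair_comp ?dd ?di pr_fstE pr_sndE.
  - exact: diE.
  - exact: ddE.
have [opp oppD] : exists w, w = d ∘ pr_pair AA (pt_zero A A) (idm A) by eexists.
have [add addD] : exists w, w = d ∘ pr_pair AA (pr_fst AA) (opp ∘ pr_snd AA).
  by eexists.
have oppE t (a : Hom t A) : opp ∘ a = d ∘ pr_pair AA (pt_zero t A) a.
  by rewrite oppD -compA pr_pair_comp pt_zero_comp comp1m.
have addE t (a b : Hom t A) : add ∘ pr_pair AA a b = d ∘ pr_pair AA a (opp ∘ b).
  by rewrite addD -!compA pr_pair_comp -compA pr_fstE pr_sndE.
have add0 t (a : Hom t A) : add ∘ pr_pair AA a (pt_zero t A) = a.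
  by rewrite addE pt_comp_zero diE.
have addC : add ∘ pr_pair AA (pr_snd AA) (pr_fst AA) = add.
  apply: pt_joint; rewrite -compA pr_pair_comp pr_fstE pr_sndE //.
  by rewrite /pt_inl add0 addE oppE dK.
have addCE t (a b : Hom t A) : add ∘ pr_pair AA a b = add ∘ pr_pair AA b a.
  by rewrite -{1}addC -compA pr_pair_comp pr_fstE pr_sndE.
have add0l t (a : Hom t A) : add ∘ pr_pair AA (pt_zero t A) a = a.
  by rewrite addCE add0.
have addA t (a b c : Hom t A) :
    add ∘ pr_pair AA a (add ∘ pr_pair AA b c) =
    add ∘ pr_pair AA (add ∘ pr_pair AA a b) c.
  pose X := pt_product AA AA.
  pose p : Hom (X : Pt Y) A := pr_fst AA ∘ pr_fst X.
  pose q : Hom (X : Pt Y) A := pr_snd AA ∘ pr_fst X.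
  pose r : Hom (X : Pt Y) A := pr_fst AA ∘ pr_snd X.
  suff e : add ∘ pr_pair AA p (add ∘ pr_pair AA q r) =
           add ∘ pr_pair AA (add ∘ pr_pair AA p q) r.
    have := f_equal (fun w => w ∘ pr_pair X (pr_pair AA a b) (pr_pair AA c c)) e.
    rewrite -!compA !pr_pair_comp -!compA !pr_pair_comp /p /q /r -!compA.
    by rewrite !(pr_fstE, pr_sndE).
  apply: pt_joint; rewrite -!compA !pr_pair_comp -!compA !pr_pair_comp
    /p /q /r -!compA !(pr_fstE, pr_sndE) ?compm1.
  - by rewrite addCE; congr (_ ∘ pr_pair _ _ _); rewrite addCE.
  - by rewrite pt_comp_zero !add0.
exists; exists add (pt_zero _ _) opp.
- exact: addA.
- exact: addC.
- by rewrite [_ ∘ tm_map _ _]pt_terminal_zero; apply: add0.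
- rewrite [RHS]pt_terminal_zero.
  by rewrite [LHS]addE oppE -[opp]compm1 oppE dK ddE.
Qed.

End Malcev.

Section RegularEpi.
Context (C : lexCategory).

Lemma regular_epi_cancel (x y t : C) (e : Hom x y) (u v : Hom y t) :
  regular_epi e -> u ∘ e = v ∘ e -> u = v.
Proof.
move=> [r [a [b [ab univ]]]] uv.
have e1 : (v ∘ e) ∘ a = (v ∘ e) ∘ b by rewrite -!compA ab.
have [w [_ w_uniq]] := univ _ _ e1.
by rewrite -(w_uniq u uv) -(w_uniq v (erefl _)).
Qed.

Lemma regular_epi_factor (x y t : C) (e : Hom x y) (k : Hom x t) :
  regular_epi e ->
  (forall s (a b : Hom s x), e ∘ a = e ∘ b -> k ∘ a = k ∘ b) ->
  exists w : Hom y t, w ∘ e = k.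
Proof.
move=> [r [a [b [ab univ]]]] kP.
by have [w [we _]] := univ _ _ (kP _ _ _ ab); exists w.
Qed.

Lemma regular_epi_iso (x y z : C) (e : Hom x y) (m : Hom y z) :
  regular_epi e -> is_iso m -> regular_epi (m ∘ e).
Proof.
move=> [r [a [b [ab univ]]]] [n [nm mn]]; exists r, a, b.
split=> [|t k kab]; first by rewrite -!compA ab.
have [w [we w_uniq]] := univ _ _ kab.
exists (w ∘ n); split; first by rewrite -compA [n ∘ _]compA nm comp1m.
by move=> w' ew; rewrite (w_uniq (w' ∘ m)) -?compA ?mn ?compm1.
Qed.

Context (reg : regular C).

Lemma regular_epi_lift (x y t : C) (e : Hom x y) (a : Hom t y) :
  regular_epi e -> exists (s : C) (p : Hom s t) (b : Hom s x),
    regular_epi p /\ e ∘ b = a ∘ p.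
Proof.
move=> re; exists (lex_pb e a), (pb_snd _), (pb_fst _).
by split; [apply: reg.2|apply: pb_comm].
Qed.

Lemma image_factorization (x y : C) (f : Hom x y) :
  exists (i : C) (e : Hom x i) (m : Hom i y),
    [/\ m ∘ e = f, regular_epi e &
        forall t (a b : Hom t i), m ∘ a = m ∘ b -> a = b].
Proof.
have [i [e [ek univ]]] := reg.1 _ _ f (lex_pb f f).
have [m [me _]] := univ _ f (pb_comm _).
have re : regular_epi e by exists _, (pb_fst (lex_pb f f)), (pb_snd _).
exists i, e, m; split=> // t a b mab.
have [t1 [s1 [a1 [rs1 ea1]]]] := regular_epi_lift a re.
have [t2 [s2 [b2 [rs2 eb2]]]] := regular_epi_lift (b ∘ s1) re.
apply: (regular_epi_cancel rs1); apply: (regular_epi_cancel rs2).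
rewrite -eb2 -ea1 -compA.
have e12 : f ∘ (a1 ∘ s2) = f ∘ b2.
  by rewrite -me -!compA eb2 [e ∘ (a1 ∘ _)]compA ea1 !compA mab.
have [w [<- <-]] := pb_ex (lex_pb f f) e12.
by rewrite !compA ek.
Qed.

End RegularEpi.

Section AssociatedAbelianObject.
Context (C : lexCategory) (cC : finitely_cocomplete C).
Context (reg : regular C) (mal : malcev C) (Y : C).

(** The cokernel of the diagonal of [P], with the unit [P -> assoc P] given by
    the restriction of the cokernel map along [(1, 0) : P -> P * P]. *)
Definition assoc (P : Pt Y) : Pt Y := coker cC (pt_diag P).

Definition assoc_coker (P : Pt Y) : Hom (pt_product P P : Pt Y) (assoc P) :=
  coker_map cC (pt_diag P).

Definition assoc_unit (P : Pt Y) : Hom P (assoc P) := assoc_coker P ∘ pt_inl P.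

Lemma assoc_cokerP (P : Pt Y) : is_cokernel (pt_diag P) (assoc_coker P).
Proof. exact: coker_mapP. Qed.

Lemma assoc_coker_diag (P : Pt Y) :
  assoc_coker P ∘ pt_diag P = pt_zero P (assoc P).
Proof. by case: (assoc_cokerP P). Qed.

Lemma assoc_unit_regular (P : Pt Y) : regular_epi (pt_map (assoc_unit P)).
Proof.
have [i [e [m [me re mm]]]] := image_factorization reg (pt_map (assoc_unit P)).
pose q : Hom (pt_dom (pt_product P P : Pt Y)) (pt_dom (assoc P)) :=
  pt_map (assoc_coker P).
pose Z : Hom (pt_dom P) (pt_dom (pt_product P P : Pt Y)) :=
  pt_map (pt_zero P (pt_product P P : Pt Y)).
have qd : q ∘ pt_map (pt_diag P) = m ∘ (e ∘ pt_map (pt_zero P P)).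
  rewrite compA me; have := f_equal (@pt_map _ _ _ _) (assoc_coker_diag P).
  by rewrite -(pt_comp_zero P (assoc_unit P)).
have qi : q ∘ pt_map (pt_inl P) = m ∘ e by rewrite me.
have [d [jd td]] := pb_ex (lex_pb q m) qd.
have [l [jl tl]] := pb_ex (lex_pb q m) qi.
have jm t (a b : Hom t (lex_pb q m)) :
    pb_fst _ ∘ a = pb_fst _ ∘ b -> a = b.
  move=> ab; apply: pb_uniq => //; apply: mm.
  by rewrite !compA -!pb_comm -!compA ab.
have [r jr] := malcev_section mal jm jd jl.
have [t mt] : exists t, m ∘ t = q.
  by exists (pb_snd (lex_pb q m) ∘ r); rewrite compA -pb_comm -compA jr compm1.
have qZ : q ∘ pt_map (pt_diag P) = q ∘ Z by apply: coeq_mapE.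
have tdZ : t ∘ pt_map (pt_diag P) = t ∘ Z by apply: mm; rewrite !(compA m t) mt qZ.
pose u : Hom (pt_dom (assoc P)) i := coeq_desc cC tdZ.
have uq : u ∘ q = t by apply: coeq_descE.
have mu : m ∘ u = idm _.
  by apply: coeq_uniq; rewrite -compA -[coeq_map _ _ _]/q uq mt; rewrite [RHS]comp1m.
rewrite -me; apply: regular_epi_iso => //; exists u; split=> //.
by apply: mm; rewrite compA mu comp1m compm1.
Qed.

Lemma assoc_unit_epi (P B : Pt Y) (u v : Hom (assoc P) B) :
  u ∘ assoc_unit P = v ∘ assoc_unit P -> u = v.
Proof.
move=> e; apply: pt_hom_eq; apply: (regular_epi_cancel (assoc_unit_regular P)).
exact: (f_equal (@pt_map _ _ _ _) e).
Qed.

Lemma pt_kernel_pair (P Q : Pt Y) (f : Hom P Q) :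
  exists (R : Pt Y) (k1 k2 : Hom R P), f ∘ k1 = f ∘ k2 /\
    forall t (a b : Hom t (pt_dom P)), pt_map f ∘ a = pt_map f ∘ b ->
      exists c : Hom t (pt_dom R), pt_map k1 ∘ c = a /\ pt_map k2 ∘ c = b.
Proof.
pose k := lex_pb (pt_map f) (pt_map f).
have es : pt_map f ∘ pt_sec P = pt_map f ∘ pt_sec P by [].
have [s [s1 s2]] := pb_ex k es.
have ps : (pt_proj P ∘ pb_fst k) ∘ s = idm Y by rewrite -compA s1 pt_split.
pose R : Pt Y := PtOb ps.
have p2 : pt_proj P ∘ pb_snd k = pt_proj R.
  by rewrite /= -(pt_map_proj f) -!compA pb_comm.
exists R, (@PtHom _ _ R P (pb_fst k) (erefl _) s1), (@PtHom _ _ R P _ p2 s2).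
split; first by apply: pt_hom_eq; apply: pb_comm.
by move=> t a b e; apply: (pb_ex k).
Qed.

Lemma assoc_coker_eq (P : Pt Y) t (a b : Hom t (pt_dom (pt_product P P : Pt Y))) :
  let k := lex_pb (pt_proj P) (pt_proj P) in
  let n := pt_map (assoc_unit P) in
  n ∘ (pb_fst k ∘ a) = n ∘ (pb_fst k ∘ b) ->
  n ∘ (pb_snd k ∘ a) = n ∘ (pb_snd k ∘ b) ->
  pt_map (assoc_coker P) ∘ a = pt_map (assoc_coker P) ∘ b.
Proof.
move=> k n e1 e2.
have [R [k1 [k2 [fk kP]]]] := pt_kernel_pair (assoc_unit P).
have [c1 [c1a c1b]] := kP _ _ _ e1; have [c2 [c2a c2b]] := kP _ _ _ e2.
pose RR := pt_product R R; pose PP := pt_product P P.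
pose K1 : Hom (RR : Pt Y) PP := pr_pair _ (k1 ∘ pr_fst RR) (k1 ∘ pr_snd RR).
pose K2 : Hom (RR : Pt Y) PP := pr_pair _ (k2 ∘ pr_fst RR) (k2 ∘ pr_snd RR).
have eK : assoc_coker P ∘ K1 = assoc_coker P ∘ K2.
  have diagE (j : Hom R P) : pr_pair PP j j = pt_diag P ∘ j.
    by rewrite pr_pair_comp comp1m.
  have inlE (j : Hom R P) : pr_pair PP j (pt_zero R P) = pt_inl P ∘ j.
    by rewrite pr_pair_comp comp1m pt_zero_comp.
  apply: (pt_joint mal); rewrite -!compA !pr_pair_comp -!compA pr_fstE pr_sndE.
  - by rewrite !compm1 !diagE !compA assoc_coker_diag !pt_zero_comp.
  - by rewrite !compm1 !pt_comp_zero !inlE !compA.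
have ec : pt_proj R ∘ c1 = pt_proj R ∘ c2.
  rewrite -(pt_map_proj k1) -!compA c1a c2a !compA; congr (_ ∘ _).
  exact: pb_comm.
have [c [cc1 cc2]] := pb_ex (lex_pb (pt_proj R) (pt_proj R)) ec.
have ka : pt_map K1 ∘ c = a.
  by apply: pb_uniq; rewrite compA /= ?pb_fstE ?pb_sndE -compA ?cc1 ?cc2.
have kb : pt_map K2 ∘ c = b.
  by apply: pb_uniq; rewrite compA /= ?pb_fstE ?pb_sndE -compA ?cc1 ?cc2.
rewrite -ka -kb !compA; congr (_ ∘ _).
exact: (f_equal (@pt_map _ _ _ _) eK).
Qed.

Lemma assoc_subtraction (P : Pt Y) :
  let A := assoc P in let AA := pt_product A A in let PP := pt_product P P in
  exists d : Hom (AA : Pt Y) A,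
    d ∘ pr_pair AA (assoc_unit P ∘ pr_fst PP) (assoc_unit P ∘ pr_snd PP) =
    assoc_coker P.
Proof.
move=> A AA PP.
pose n : Hom (pt_dom P) (pt_dom A) := pt_map (assoc_unit P).
have rn : regular_epi n := assoc_unit_regular P.
have np : pt_proj A ∘ n = pt_proj P := pt_map_proj (assoc_unit P).
have npE t (a : Hom t (pt_dom P)) : pt_proj P ∘ a = pt_proj A ∘ (n ∘ a).
  by rewrite compA np.
pose kPP := lex_pb (pt_proj P) (pt_proj P).
pose kAP := lex_pb (pt_proj A) (pt_proj P).
pose kAA := lex_pb (pt_proj A) (pt_proj A).
have rE (x y z : C) (e : Hom x y) (g : Hom z y) w (k1 : Hom w x) (k2 : Hom w z) :
    regular_epi e -> e ∘ k1 = g ∘ k2 ->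
    (forall t (a : Hom t x) (b : Hom t z), e ∘ a = g ∘ b ->
       exists c : Hom t w, k1 ∘ c = a /\ k2 ∘ c = b) ->
    (forall t (u v : Hom t w), k1 ∘ u = k1 ∘ v -> k2 ∘ u = k2 ∘ v -> u = v) ->
    regular_epi k2.
  move=> re ek kP ku.
  have sP t (a : Hom t x) (b : Hom t z) (h : e ∘ a = g ∘ b) :
      {c : Hom t w | k1 ∘ c = a /\ k2 ∘ c = b}.
    exact: constructive_indefinite_description (kP _ _ _ h).
  apply: (reg.2 _ _ _ e g (@Pullback _ _ _ _ e g w k1 k2 ek
    (fun t a b h => sval (sP t a b h)) (fun t a b h => (svalP (sP t a b h)).1)
    (fun t a b h => (svalP (sP t a b h)).2) ku)) => //.
have h1 : pt_proj A ∘ (n ∘ pb_fst kPP) = pt_proj P ∘ pb_snd kPP.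
  by rewrite compA np pb_comm.
have [e1 [e1f e1s]] := pb_ex kAP h1.
have re1 : regular_epi e1.
  apply: (rE _ _ _ n (pb_fst kAP) _ (pb_fst kPP) e1) => //.
  - move=> t a b nab.
    have h : pt_proj P ∘ a = pt_proj P ∘ (pb_snd kAP ∘ b).
      by rewrite npE nab !compA pb_comm.
    have [c [ca cb]] := pb_ex kPP h; exists c; split=> //.
    apply: pb_uniq; first by rewrite compA e1f -compA ca.
    by rewrite compA e1s.
  - move=> t u v e e'; apply: pb_uniq => //.
    by rewrite -e1s -!compA e'.
have h2 : pt_proj A ∘ pb_fst kAP = pt_proj A ∘ (n ∘ pb_snd kAP).
  by rewrite compA np pb_comm.
have [e2 [e2f e2s]] := pb_ex kAA h2.
have re2 : regular_epi e2.
  apply: (rE _ _ _ n (pb_snd kAA) _ (pb_snd kAP) e2) => //.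
  - move=> t a b nab.
    have h : pt_proj A ∘ (pb_fst kAA ∘ b) = pt_proj P ∘ a.
      by rewrite npE nab !compA pb_comm.
    have [c [cb ca]] := pb_ex kAP h; exists c; split=> //.
    apply: pb_uniq; first by rewrite compA e2f.
    by rewrite compA e2s -compA ca.
  - move=> t u v e e'; apply: pb_uniq => //.
    by rewrite -e2f -!compA e'.
pose q : Hom (pt_dom (PP : Pt Y)) (pt_dom A) := pt_map (assoc_coker P).
have [d1 d1e] : exists d1, d1 ∘ e1 = q.
  apply: regular_epi_factor => // t a b eab; apply: assoc_coker_eq.
  - by rewrite -/n -/kPP compA -e1f -compA eab compA e1f -compA.
  - by rewrite -/n -/kPP -e1s -!compA eab.
have [d de] : exists d, d ∘ e2 = d1.
  apply: regular_epi_factor => // t a b eab.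
  have ef : pb_fst kAP ∘ a = pb_fst kAP ∘ b by rewrite -e2f -!compA eab.
  have es : n ∘ (pb_snd kAP ∘ a) = n ∘ (pb_snd kAP ∘ b).
    by rewrite !compA -e2s -!compA eab.
  have [s [p [x [rp nx]]]] := regular_epi_lift reg (pb_fst kAP ∘ a) rn.
  apply: (regular_epi_cancel rp).
  have ha : pt_proj P ∘ x = pt_proj P ∘ (pb_snd kAP ∘ a ∘ p).
    by rewrite npE nx !compA pb_comm.
  have hb : pt_proj P ∘ x = pt_proj P ∘ (pb_snd kAP ∘ b ∘ p).
    by rewrite npE nx ef !compA pb_comm.
  have [ya [ya1 ya2]] := pb_ex kPP ha; have [yb [yb1 yb2]] := pb_ex kPP hb.
  have ea : a ∘ p = e1 ∘ ya.
    apply: pb_uniq; first by rewrite [RHS]compA e1f -[RHS]compA ya1 nx compA.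
    by rewrite !compA e1s ya2.
  have eb : b ∘ p = e1 ∘ yb.
    apply: pb_uniq; first by rewrite [RHS]compA e1f -[RHS]compA yb1 nx ef compA.
    by rewrite !compA e1s yb2.
  rewrite -!compA ea eb !compA d1e; apply: assoc_coker_eq.
  - by rewrite -/n -/kPP ya1 yb1.
  - by rewrite -/n -/kPP ya2 yb2 !compA -[_ ∘ _ ∘ a]compA es compA.
pose N : Hom (PP : Pt Y) AA :=
  pr_pair AA (assoc_unit P ∘ pr_fst PP) (assoc_unit P ∘ pr_snd PP).
have NE : pt_map N = e2 ∘ e1.
  have Nf : pb_fst kAA ∘ pt_map N = n ∘ pb_fst kPP.
    have := pr_fstE AA (assoc_unit P ∘ pr_fst PP) (assoc_unit P ∘ pr_snd PP).
    exact: (f_equal (@pt_map _ _ _ _)).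
  have Ns : pb_snd kAA ∘ pt_map N = n ∘ pb_snd kPP.
    have := pr_sndE AA (assoc_unit P ∘ pr_fst PP) (assoc_unit P ∘ pr_snd PP).
    exact: (f_equal (@pt_map _ _ _ _)).
  apply: pb_uniq.
  - by rewrite [LHS]Nf [RHS]compA e2f e1f.
  - by rewrite [LHS]Ns [RHS]compA e2s -[RHS]compA e1s.
have dN : d ∘ pt_map N = q by rewrite NE compA de.
have dp : pt_proj A ∘ d = pt_proj (AA : Pt Y).
  apply: (regular_epi_cancel re2); apply: (regular_epi_cancel re1).
  rewrite -[RHS]compA -NE -[LHS]compA -NE -[LHS]compA dN.
  exact: etrans (pt_map_proj (assoc_coker P)) (esym (pt_map_proj N)).
have ds : d ∘ pt_sec (AA : Pt Y) = pt_sec A.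
  rewrite -(pt_map_sec N) compA dN; exact: pt_map_sec (assoc_coker P).
by exists (@PtHom _ _ (AA : Pt Y) A d dp ds); apply: pt_hom_eq.
Qed.

Lemma assoc_abelian (P : Pt Y) : abelian_object (pt_products Y) (assoc P).
Proof.
have [d dN] := assoc_subtraction P.
have dE t (a b : Hom t P) :
    d ∘ pr_pair _ (assoc_unit P ∘ a) (assoc_unit P ∘ b) =
    assoc_coker P ∘ pr_pair _ a b.
  by rewrite -dN -compA pr_pair_comp -!compA pr_fstE pr_sndE.
apply: (subtraction_abelian mal (d := d)); apply: assoc_unit_epi;
  rewrite -compA pr_pair_comp ?pt_zero_comp comp1m.
- rewrite -[assoc_unit P]compm1 dE -/(pt_diag P) assoc_coker_diag //.
- rewrite -(pt_comp_zero P (assoc_unit P)) -{1}[assoc_unit P]compm1 dE //.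
Qed.

Lemma assoc_universal (P B : Pt Y) (f : Hom P B) :
  abelian_object (pt_products Y) B ->
  exists! g : Hom (assoc P) B, g ∘ assoc_unit P = f.
Proof.
move=> [G]; pose PP := pt_product P P.
have zE t : ag_zero G ∘ tm_map _ t = pt_zero t B.
  by rewrite -(pt_zero_comp B (pt_zero t B)) -(pt_terminal_zero (ag_zero G)) -compA;
    congr (_ ∘ _); apply: (tm_uniq (t := pt_terminal Y)).
pose k : Hom (PP : Pt Y) B :=
  ag_add G ∘ pr_pair _ (f ∘ pr_fst PP) (ag_opp G ∘ (f ∘ pr_snd PP)).
have kE t (a b : Hom t P) : k ∘ pr_pair PP a b =
    ag_add G ∘ pr_pair _ (f ∘ a) (ag_opp G ∘ (f ∘ b)).
  by rewrite -compA pr_pair_comp -!compA pr_fstE pr_sndE.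
have kd : k ∘ pt_diag P = pt_zero P B by rewrite kE ag_addNE zE.
have [g [ge _]] := (assoc_cokerP P).2 _ _ kd.
have gu : g ∘ assoc_unit P = f.
  by rewrite compA ge kE !pt_comp_zero compm1 -zE ag_add0E.
by exists g; split=> // g' e; apply: assoc_unit_epi; rewrite gu e.
Qed.

End AssociatedAbelianObject.

Section Reflection.
Context (C : lexCategory) (cC : finitely_cocomplete C).
Context (reg : regular C) (mal : malcev C) (Y : C).

Definition assoc_Ab (P : Pt Y) : Ab Y :=
  exist _ (assoc cC P) (assoc_abelian cC reg mal P).

Lemma assoc_desc_subproof (P : Pt Y) (B : Ab Y) (f : Hom P (Ab_incl Y B)) :
  exists g : Hom (assoc cC P) (Ab_incl Y B), g ∘ assoc_unit cC P = f.
Proof.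
have [g [ge _]] := assoc_universal cC reg mal f (proj2_sig B).
by exists g.
Qed.

Definition assoc_desc (P : Pt Y) (B : Ab Y) (f : Hom P (Ab_incl Y B)) :
    Hom (assoc_Ab P) B :=
  sval (constructive_indefinite_description _ (assoc_desc_subproof f)).

Lemma assoc_descE (P : Pt Y) (B : Ab Y) (f : Hom P (Ab_incl Y B)) :
  fmap (Ab_incl Y) (assoc_desc f) ∘ assoc_unit cC P = f.
Proof.
exact: (svalP (constructive_indefinite_description _ (assoc_desc_subproof f))).
Qed.

Lemma assoc_desc_uniq (P : Pt Y) (B : Ab Y) (u v : Hom (assoc_Ab P) B) :
  fmap (Ab_incl Y) u ∘ assoc_unit cC P = fmap (Ab_incl Y) v ∘ assoc_unit cC P ->
  u = v.
Proof. exact: (assoc_unit_epi reg mal). Qed.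

Definition assoc_map (P Q : Pt Y) (f : Hom P Q) : Hom (assoc_Ab P) (assoc_Ab Q) :=
  @assoc_desc P (assoc_Ab Q) (assoc_unit cC Q ∘ f).

#[local] Obligation Tactic := idtac.

Program Definition A_ : functor (Pt Y) (Ab Y) :=
  {| fob := assoc_Ab; fmap := assoc_map |}.
Next Obligation.
move=> P; apply: (@assoc_desc_uniq P (assoc_Ab P)).
by rewrite [LHS]assoc_descE compm1; exact: (esym (comp1m _)).
Qed.
Next Obligation.
move=> P Q R g f; apply: (@assoc_desc_uniq P (assoc_Ab R)).
apply: etrans (@assoc_descE P (assoc_Ab R) _) _.
have ef : fmap (Ab_incl Y) (assoc_map f) ∘ assoc_unit cC P = assoc_unit cC Q ∘ f.
  exact: (@assoc_descE P (assoc_Ab Q)).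
have eg : fmap (Ab_incl Y) (assoc_map g) ∘ assoc_unit cC Q = assoc_unit cC R ∘ g.
  exact: (@assoc_descE Q (assoc_Ab R)).
by rewrite fmapM -[RHS]compA ef [RHS]compA eg compA.
Qed.

Program Definition A_adjunction : adjunction A_ (Ab_incl Y) :=
  {| transpose := fun P B g => fmap (Ab_incl Y) g ∘ assoc_unit cC P;
     untranspose := fun P B f => assoc_desc f |}.
Next Obligation.
move=> P B g; apply: (@assoc_desc_uniq P B); exact: assoc_descE.
Qed.
Next Obligation. by move=> P B f; apply: assoc_descE. Qed.
Next Obligation.
move=> P P' B B' u g v.
rewrite -[LHS]/(fmap (Ab_incl Y) (v ∘ g ∘ assoc_map u) ∘ assoc_unit cC P').
rewrite !fmapM.
have eu : fmap (Ab_incl Y) (assoc_map u) ∘ assoc_unit cC P' = assoc_unit cC P ∘ u.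
  exact: (@assoc_descE P' (assoc_Ab P)).
by rewrite -[LHS]compA eu -[LHS]compA -[RHS]compA -[in RHS]compA.
Qed.

End Reflection.

Section PeriAbelian.
Context (C : lexCategory) (cC : finitely_cocomplete C).
Context (reg : regular C) (mal : malcev C).

(** The canonical comparison [A_Y (h^* P) -> h^* (A_Y' P)]: the map
    corresponding to [h^*] of the unit [P -> A_Y' P] under the adjunction
    between [A_Y] and the inclusion. *)
Definition peri_comparison (Y Y' : C) (h : Hom Y Y') (P : Pt Y') :
    Hom (A_ cC reg mal Y (change_of_base h P))
        (cob_Ab h (A_ cC reg mal Y' P)) :=
  @untranspose _ _ _ _ (A_adjunction cC reg mal Y)
    (change_of_base h P) (cob_Ab h (A_ cC reg mal Y' P))
    (fmap (change_of_base h) (assoc_unit cC P)).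

Lemma peri_comparisonE (Y Y' : C) (h : Hom Y Y') (P : Pt Y') :
  fmap (Ab_incl Y) (peri_comparison h P) ∘ assoc_unit cC (change_of_base h P) =
  fmap (change_of_base h) (assoc_unit cC P).
Proof. exact: assoc_descE. Qed.

Definition peri_abelian : Prop :=
  forall (Y Y' : C) (h : Hom Y Y') (P : Pt Y'), is_iso (peri_comparison h P).

End PeriAbelian.

(* Main.v *)
From mathcomp Require Import ssreflect ssrfun ssrbool.
Require Import Defs.

Set Implicit Arguments.
Unset Strict Implicit.
Unset Printing Implicit Defensive.

Local Open Scope cat_scope.

(** The associated abelian object of a point is a cokernel, and a functor with a
    right adjoint preserves cokernels of points: this is why right adjoints to
    the functors [h^*] make [C] peri-abelian.

    In detail, let [F = h^*] and let [g : A (F P) -> F (A P)] be the comparison,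
    determined by [g ∘ eta = F eta]. Transposing along the adjunction shows that
    the map [F (P * P) -> F P * F P -> A (F P)], which kills the image of the
    diagonal under [F], factors through the image under [F] of the cokernel of
    the diagonal ([left_adjoint_cokernel]). The resulting map
    [v : F (A P) -> A (F P)] satisfies [v ∘ F eta = eta]. Both [eta] and [F eta]
    are epimorphisms, the former because [C] is regular and Mal'cev and the
    latter because left adjoints preserve epimorphisms, so [v] and [g] are
    mutually inverse. *)

Section Adjunctions.
Context (C D : category) (F : functor C D) (G : functor D C).
Context (adj : adjunction F G).

Lemma transpose_natl (x x' : C) (y : D) (u : Hom x' x) (f : Hom (F x) y) :
  transpose adj (f ∘ fmap F u) = transpose adj f ∘ u.
Proof. by rewrite -[f]comp1m transpose_nat fmap1 !comp1m. Qed.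

Lemma left_adjoint_epi (x y : C) (e : Hom x y) :
  (forall (z : C) (u v : Hom y z), u ∘ e = v ∘ e -> u = v) ->
  forall (z : D) (u v : Hom (F y) z), u ∘ fmap F e = v ∘ fmap F e -> u = v.
Proof.
move=> epi z u v uv; rewrite -(transposeK adj u) -(transposeK adj v).
by congr untranspose; apply: epi; rewrite -!transpose_natl uv.
Qed.

End Adjunctions.

Section PointedAdjunctions.
Context (C D : category) (Y : C) (Z : D).
Context (F : functor (Pt Y) (Pt Z)) (G : functor (Pt Z) (Pt Y)).
Context (adj : adjunction F G).

(** A zero map out of [F P] is a composite [0 ∘ F 0], so its transpose factors
    through a zero map. *)
Lemma transpose_zero (P : Pt Y) (B : Pt Z) :
  transpose adj (pt_zero (F P) B) = pt_zero P (G B).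
Proof.
by rewrite -(pt_zero_comp B (fmap F (pt_zero P P))) transpose_natl pt_comp_zero.
Qed.

Lemma left_adjoint_zero (P Q : Pt Y) :
  fmap F (pt_zero P Q) = pt_zero (F P) (F Q).
Proof.
rewrite -[LHS]comp1m -[LHS](transposeK adj) transpose_natl pt_comp_zero.
by rewrite -transpose_zero transposeK.
Qed.

Lemma left_adjoint_cokernel (P Q K : Pt Y) (u : Hom P Q) (e : Hom Q K)
    (B : Pt Z) (k : Hom (F Q) B) :
  is_cokernel u e -> k ∘ fmap F u = pt_zero (F P) B ->
  exists v : Hom (F K) B, v ∘ fmap F e = k.
Proof.
move=> [_ univ] ku.
have k'u : transpose adj k ∘ u = pt_zero P (G B).
  by rewrite -transpose_natl ku transpose_zero.
have [w [we _]] := univ _ _ k'u.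
exists (untranspose adj w); rewrite -[RHS](transposeK adj) -we.
by rewrite -[LHS](transposeK adj) transpose_natl untransposeK.
Qed.

End PointedAdjunctions.

Section Comparison.
Context (C : lexCategory) (cC : finitely_cocomplete C) (Y Y' : C).
Context (F : functor (Pt Y') (Pt Y)) (G : functor (Pt Y) (Pt Y')).
Context (adj : adjunction F G).

(** The canonical map [c : F (P * P) -> F P * F P] carries the images under [F]
    of the diagonal and of [(1, 0)] to the diagonal and [(1, 0)] of [F P]. Hence
    the cokernel map of [F P] composed with [c] factors through [F (assoc P)],
    and the factorization can be evaluated on the image of the unit. *)
Lemma left_adjoint_assoc (P : Pt Y') :
  exists v : Hom (F (assoc cC P)) (assoc cC (F P)),
    v ∘ fmap F (assoc_unit cC P) = assoc_unit cC (F P).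
Proof.
pose PP := pt_product P P.
pose c : Hom (F PP) (pt_product (F P) (F P)) :=
  pr_pair _ (fmap F (pr_fst PP)) (fmap F (pr_snd PP)).
have cE (a b : Hom P P) :
    c ∘ fmap F (pr_pair PP a b) = pr_pair _ (fmap F a) (fmap F b).
  by rewrite pr_pair_comp -!fmapM pr_fstE pr_sndE.
have cdiag : c ∘ fmap F (pt_diag P) = pt_diag (F P) by rewrite cE fmap1.
have kd : (assoc_coker cC (F P) ∘ c) ∘ fmap F (pt_diag P) =
    pt_zero (F P) (assoc cC (F P)).
  by rewrite -compA cdiag assoc_coker_diag.
have [v vE] := left_adjoint_cokernel adj (assoc_cokerP cC P) kd.
exists v; rewrite /assoc_unit fmapM compA vE -compA cE.
by rewrite fmap1 (left_adjoint_zero adj).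
Qed.

End Comparison.

Theorem theorem4p5 (C : lexCategory) (cC : finitely_cocomplete C)
    (reg : regular C) (mal : malcev C) :
  locally_algebraically_cartesian_closed C -> peri_abelian cC reg mal.
Proof.
move=> lacc Y Y' h P; have [G [adj]] := lacc _ _ h.
pose F := change_of_base h.
have [v vE] := left_adjoint_assoc cC adj P.
pose g : Hom (assoc cC (F P)) (F (assoc cC P)) :=
  fmap (Ab_incl Y) (peri_comparison cC reg mal h P).
have gE : g ∘ assoc_unit cC (F P) = fmap F (assoc_unit cC P).
  exact: peri_comparisonE.
exists v; split.
- by apply: (assoc_unit_epi reg mal); rewrite -[LHS]compA gE vE [RHS]comp1m.
- apply: (left_adjoint_epi adj (assoc_unit_epi reg mal (P := P))).
  by rewrite -[LHS]compA vE gE [RHS]comp1m.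
Qed.
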